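(* Let $q\geq 2$, $k\geq 2$ and $t\in\{1,\ldots,k-1\}$ be integers where $q$ is a prime power, and let $I$ be an instance of $\mathsf{k\,CSP}(\mathcal{I}_q^t)$ with strong chromatic number $\nu\in\{k,\ldots,\max\{k+t+1,q+t+2\}\}$. Then: (i) if $\nu-t\leq k$, the average differential ratio on $I$ is bounded below by $1/q^{\nu-t}$; (ii) if $\nu-t\leq k+1$, or $q>k$ and $\nu-t\leq q+1$, or $k=3$, $q>3$, $q$ is a power of 2, and $\nu-t\leq q+2$, this ratio is at least $1/q^k$.
   Context: Let $\Sigma_q=\{0,1,\ldots,q-1\}$ and $[n]=\{1,\ldots,n\}$. An instance $I$ of $\mathsf{k\,CSP\!-\!q}$ consists of integers $n,m\ge 1$, a goal (maximize or minimize) and, for each $i\in[m]$, a weight $w_i>0$, an integer $1\le k_i\leq \min\{k,n\}$, a strictly increasing sequence $J_i=(i_1,\ldots,i_{k_i})$ of indices of $[n]$, and a function $P_i:\Sigma_q^{k_i}\to\mathbb{R}$. Solutions are vectors $x\in\Sigma_q^n$, with value $v(I,x)=\sum_{i=1}^m w_iP_i(x_{i_1},\ldots,x_{i_{k_i}})$. $\mathrm{opt}(I)$ and $\mathrm{wor}(I)$ are the best and worst solution values (maximum and minimum of $v(I,\cdot)$ if maximizing, minimum and maximum if minimizing). The average differential ratio on $I$ is $(\mathbb{E}_X[v(I,X)]-\mathrm{wor}(I))/(\mathrm{opt}(I)-\mathrm{wor}(I))$ with $X$ uniform on $\Sigma_q^n$ (considered when $\mathrm{opt}(I)\neq\mathrm{wor}(I)$).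 The strong chromatic number of $I$ is the smallest $\nu$ such that there is a partition of $[n]$ into $\nu$ sets such that each $J_i$ contains at most one index from each set. A function $P:\Sigma_q^h\to\mathbb{R}$ with $h\geq t$ and mean value $r_P=q^{-h}\sum_y P(y)$ belongs to $\mathcal{I}_q^t$ (is balanced $t$-wise independent) iff for all indices $j_1<\cdots<j_t$ in $[h]$ and all $v\in\Sigma_q^t$, $\sum_{y\in\Sigma_q^h:\,(y_{j_1},\ldots,y_{j_t})=v}P(y)/q^{h-t}=r_P$. $\mathsf{k\,CSP}(\mathcal{I}_q^t)$ is the restriction of $\mathsf{k\,CSP\!-\!q}$ to instances with all $P_i\in\mathcal{I}_q^t$. *)

(* Defs.v *)
From HB Require Import structures.
From mathcomp Require Import all_boot all_order all_algebra.
From mathcomp Require Import reals.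

Set Implicit Arguments.
Unset Strict Implicit.
Unset Printing Implicit Defensive.

Import Order.TTheory GRing.Theory Num.Theory.
Local Open Scope ring_scope.

(* Sigma_q is ['I_q] and Sigma_q^h is [word q h]; the index set {1, ..., n}
   is represented by ['I_n], that is, indices start at 0. *)
Definition word (q h : nat) := {ffun 'I_h -> 'I_q}.

Definition increasing (h n : nat) (J : 'I_h -> 'I_n) : Prop :=
  forall a b : 'I_h, (a < b)%N -> (J a < J b)%N.

Definition subword (q n h : nat) (J : 'I_h -> 'I_n) (x : word q n) : word q h :=
  [ffun j => x (J j)].

Definition mean (R : realType) (q h : nat) (P : word q h -> R) : R :=
  (\sum_y P y) / q%:R ^+ h.

Definition balanced_indep (R : realType) (q t h : nat) (P : word q h -> R) : Prop :=
  (t <= h)%N /\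
  forall J : 'I_t -> 'I_h, increasing J -> forall v : word q t,
    (\sum_(y | subword J y == v) P y) / q%:R ^+ (h - t) = mean P.

Inductive csp_goal := Maximize | Minimize.

Record csp (R : realType) (k q : nat) := Csp {
  nvar : nat;
  ncon : nat;
  goal : csp_goal;
  weight : 'I_ncon -> R;
  arity : 'I_ncon -> nat;
  con_scope : forall i : 'I_ncon, 'I_(arity i) -> 'I_nvar;
  payoff : forall i : 'I_ncon, word q (arity i) -> R;
  nvar_gt0 : (0 < nvar)%N;
  ncon_gt0 : (0 < ncon)%N;
  weight_gt0 : forall i, 0 < weight i;
  arity_bounds : forall i, (1 <= arity i <= minn k nvar)%N;
  scope_increasing : forall i, increasing (@con_scope i)
}.

Definition csp_indep (R : realType) (k q t : nat) (I : csp R k q) : Prop :=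
  forall i, balanced_indep t (@payoff R k q I i).

Definition value (R : realType) (k q : nat) (I : csp R k q)
    (x : word q (nvar I)) : R :=
  \sum_i weight i * payoff (subword (@con_scope R k q I i) x).

(* The default value 0 is returned only when [T] is empty. *)
Definition max_val (R : realType) (T : finType) (f : T -> R) : R :=
  if [pick x | [forall y, f y <= f x]] is Some x then f x else 0.

Definition min_val (R : realType) (T : finType) (f : T -> R) : R :=
  if [pick x | [forall y, f x <= f y]] is Some x then f x else 0.

Definition opt (R : realType) (k q : nat) (I : csp R k q) : R :=
  match goal I with
  | Maximize => max_val (@value R k q I)
  | Minimize => min_val (@value R k q I)
  end.

Definition wor (R : realType) (k q : nat) (I : csp R k q) : R :=
  match goal I with
  | Maximize => min_val (@value R k q I)
  | Minimize => max_val (@value R k q I)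
  end.

(* Meaningful only when [opt I != wor I]. *)
Definition avg_diff_ratio (R : realType) (k q : nat) (I : csp R k q) : R :=
  (mean (@value R k q I) - wor I) / (opt I - wor I).

Definition strong_coloring (R : realType) (k q : nat) (I : csp R k q)
    (D : {set {set 'I_(nvar I)}}) : bool :=
  partition D [set: 'I_(nvar I)] &&
  [forall i, [forall V in D, #|[set @con_scope R k q I i j | j : 'I_(arity i)] :&: V| <= 1]]%N.

Definition strong_colorable (R : realType) (k q : nat) (I : csp R k q)
    (nu : nat) : bool :=
  [exists D : {set {set 'I_(nvar I)}}, strong_coloring D && (#|D| == nu)].

Lemma ex_strong_colorable (R : realType) (k q : nat) (I : csp R k q) :
  exists nu, strong_colorable I nu.
Proof.
pose D := [set [set j] | j : 'I_(nvar I)].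
exists #|D|; apply/existsP; exists D; rewrite eqxx andbT.
apply/andP; split; last first.
  apply/forallP => i; apply/forall_inP => _ /imsetP[j _ ->].
  by rewrite (leq_trans (subset_leq_card (subsetIr _ _))) ?cards1.
apply/and3P; split.
- apply/eqP/setP => j; rewrite inE; apply/bigcupP.
  by exists [set j]; rewrite ?set11 ?imset_f.
- apply/trivIsetP => _ _ /imsetP[a _ ->] /imsetP[b _ ->] ab.
  rewrite disjoints1 inE; apply: contraNN ab => /eqP->; exact: eqxx.
- by apply/imsetP => -[a _ /setP/(_ a)]; rewrite !inE eqxx.
Qed.

Definition strong_chromatic (R : realType) (k q : nat) (I : csp R k q) : nat :=
  ex_minn (ex_strong_colorable I).

Definition prime_power (q : nat) : Prop :=
  exists p e : nat, [/\ prime p, (0 < e)%N & q = (p ^ e)%N].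

Lemma max_valP (R : realType) (T : finType) (f : T -> R) (x0 : T) :
  (exists x, max_val f = f x) /\ forall y, f y <= max_val f.
Proof.
rewrite /max_val; case: pickP => [x /forallP fx|no]; first by split; first by exists x.
have [x _ fx] := @Order.TotalTheory.arg_maxP _ _ _ x0 xpredT f isT.
by have /negP[] := negbT (no x); apply/forallP => y; exact: fx.
Qed.

Lemma min_valP (R : realType) (T : finType) (f : T -> R) (x0 : T) :
  (exists x, min_val f = f x) /\ forall y, min_val f <= f y.
Proof.
rewrite /min_val; case: pickP => [x /forallP fx|no]; first by split; first by exists x.
have [x _ fx] := @Order.TotalTheory.arg_minP _ _ _ x0 xpredT f isT.
by have /negP[] := negbT (no x); apply/forallP => y; exact: fx.
Qed.

(* Main.v *)
Require Import Defs.
From mathcomp Require Import all_boot all_order all_fingroup all_algebra all_field.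
From mathcomp Require Import reals zify.

Set Implicit Arguments.
Unset Strict Implicit.

Import Order.TTheory GRing.Theory Num.Theory.
Local Open Scope ring_scope.

(** Fix an optimal solution [x0] and a strong colouring with [nu = t + N]
    classes.  Consider only the solutions that agree with [x0] on the first [t]
    classes and whose entries in each of the other [N] classes all come from one
    symbol of a word [c] in a code [C] of length [N], through permutations of
    the alphabet that depend on the variable but not on [c] ([perturb]).  Suppose that [C] is MDS of dimension [d]: it
    has [q ^ d] words, and two of them agree in fewer than [d] places.  Any [d]
    coordinates of a random word of [C] are then uniform and independent.

    Look at one constraint.  Its scope meets each class at most once.  The at
    most [t] entries in the first [t] classes are constant, and the others are
    jointly uniform as soon as there are at most [d] of them, which holds when
    [minn k N <= d].  Since the payoff is balanced [t]-wise independent, its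
    mean does not change when at most [t] entries are fixed.  Hence the average
    of the value over [C] is the mean value of the instance
    ([value_sum_mds]).  One word of [C] yields [x0] itself and the others do no
    worse than [wor I], so the average differential ratio is at least
    [1 / q ^ d] ([ratio_ge_of_mds]).

    What remains is to supply codes.  For (i), all words of length [N] form an
    MDS code of dimension [N].  For (ii), a code of dimension [k] is needed:
    the parity-check code if [N = k + 1], the Reed-Solomon code extended by a
    point at infinity if [N <= q + 1], and the code of a hyperoval of the
    projective plane if [k = 3], [q] is even and [N <= q + 2].  The case
    [N <= k] of (ii) follows from (i). *)

(** * Finite functions with prescribed restriction *)

Section Agree.
Variables X T : finType.
Implicit Types (S : {set X}) (u y : {ffun X -> T}).

Definition agree S u y := [forall i in S, y i == u i].

Lemma agreeP S u y : reflect {in S, y =1 u} (agree S u y).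
Proof.
apply: (iffP forall_inP) => H i /H; first by move/eqP.
by move=> ->.
Qed.

Definition splice S u y : {ffun X -> T} := [ffun i => if i \in S then y i else u i].

Lemma card_agree S u : #|[set y | agree S u y]| = (#|T| ^ #|~: S|)%N.
Proof.
pose F i := if i \in S then pred1 (u i) else predT.
rewrite (eq_card (B := mem (family F))) => [|y]; last first.
  rewrite inE; apply/agreeP/familyP => yF i; rewrite /F; have := yF i.
    by case: ifP => // iS yi; rewrite inE yi.
  by move=> yi iS; move: yi; rewrite /F iS inE => /eqP.
rewrite card_family foldrE big_map big_enum /=.
rewrite (bigID (mem S)) /= big1 => [|i iS]; last by rewrite /F iS card1.
rewrite mul1n (eq_bigr (fun=> #|T|)) => [|i /negPf iS].
  by rewrite prod_nat_const; congr (_ ^ _)%N; apply: eq_card => i; rewrite !inE.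
by rewrite /F iS; apply: eq_card.
Qed.

Lemma extend_set S m : (#|S| <= m <= #|X|)%N ->
  exists2 S' : {set X}, S \subset S' & #|S'| = m.
Proof.
elim: m => [|m IH] /andP[].
  by rewrite leqn0 cards_eq0 => /eqP-> _; exists set0; rewrite ?cards0.
rewrite leq_eqVlt => /predU1P[<- _|Sm mX]; first by exists S.
have [|S' SS' S'm] := IH; first by rewrite -ltnS Sm ltnW.
have [i iS'] : exists i, i \notin S'.
  apply/existsP; rewrite -negb_forall; apply: contraL mX => /forallP S'T.
  by rewrite -leqNgt -S'm subset_leq_card //; apply/subsetP.
exists (i |: S'); first exact: subset_trans SS' (subsetUr _ _).
by rewrite cardsU1 iS' S'm.
Qed.

(** The agreement classes on [S] split into agreement classes on [S'], one for
    each choice of values on [S' :\: S].  This gives at once that [t]-wise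
    independence implies [s]-wise independence for [s <= t], and that an
    orthogonal array of strength [d] has every smaller strength. *)
Lemma sum_agree_sub (V : nmodType) (f : {ffun X -> T} -> V) S S' u r :
    S \subset S' -> (forall z, \sum_(y | agree S' z y) f y = r) ->
  \sum_(y | agree S u y) f y = r *+ #|T| ^ (#|S'| - #|S|).
Proof.
move=> SS' fS'.
(* [splice S' u] forgets the values outside [S'], so that its fibres are the
   agreement classes on [S']. *)
rewrite (partition_big (splice S' u)
  (fun z => z \in [set z | agree (S :|: ~: S') u z])) /= => [|y /agreeP yu].
  rewrite (eq_bigr (fun=> r)) => [|z].
    rewrite sumr_const card_agree setCU setCK; congr (_ *+ _ ^ _)%N.
    by rewrite setIC -setDE cardsD (setIidPr SS').
  rewrite inE => /agreeP zu; rewrite -(fS' z); apply: eq_bigl => y.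
  apply/andP/agreeP => [[_ /eqP<-] i iS'|yz]; first by rewrite ffunE iS'.
  split; first by apply/agreeP => i iS; rewrite yz ?zu ?inE ?iS ?(subsetP SS').
  apply/eqP/ffunP => i; rewrite ffunE; case: ifPn => [/yz //|iS'].
  by rewrite zu // !inE iS' orbT.
rewrite inE; apply/agreeP => i; rewrite !inE ffunE.
by case/orP => [iS|/negPf->//]; rewrite (subsetP SS') // yu.
Qed.

End Agree.

(** * MDS codes as orthogonal arrays *)

(** Maximum distance separable codes of dimension [d], linear or not: the
    Hamming distance is at least [N - d + 1], and the Singleton bound on the
    number of words is attained. *)
Definition mds (T : finType) (N d : nat) (C : {set {ffun 'I_N -> T}}) :=
  #|C| = (#|T| ^ d)%N /\
  {in C &, forall c c' : {ffun 'I_N -> T}, c != c' -> #|[set i | c i == c' i]| < d}%N.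

Lemma mds_setT (T : finType) N : mds N [set: {ffun 'I_N -> T}].
Proof.
split=> [|c c' _ _ cc']; first by rewrite cardsT card_ffun card_ord.
rewrite -[X in (_ < X)%N]card_ord -cardsT proper_card // properT.
by apply: contraNN cc' => /eqP/setP E; apply/eqP/ffunP => i;
   have := E i; rewrite !inE => /eqP.
Qed.

(** An MDS code is an orthogonal array of strength [d].  On [d] places the
    restriction map is injective on [C], hence bijective by counting; fewer
    places are handled by [sum_agree_sub].  The count is written as a sum of
    indicators so that the same lemma serves for codes and for payoffs. *)
Lemma mds_sum_agree (R : realType) (T : finType) N d (C : {set {ffun 'I_N -> T}})
    (S : {set 'I_N}) (u : {ffun 'I_N -> T}) :
    mds d C -> (d <= N)%N -> (#|S| <= d)%N ->
  \sum_(c | agree S u c) (c \in C)%:R = #|T|%:R ^+ (d - #|S|) :> R.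
Proof.
move=> [cardC distC] dN Sd.
have [|S' SS' S'd] := @extend_set _ S d; first by rewrite Sd card_ord.
rewrite (sum_agree_sub (r := 1) u SS') => [|z]; first by rewrite S'd natrX.
have inj : {in C &, injective (splice S' z)}.
  move=> c c' cC c'C E; apply: contraTeq isT => cc'.
  have := distC _ _ cC c'C cc'; rewrite ltnNge -S'd subset_leq_card //.
  apply/subsetP => i iS'; rewrite inE.
  by move/ffunP/(_ i): E; rewrite !ffunE iS' => ->.
have sub : splice S' z @: C \subset [set y | agree (~: S') z y].
  apply/subsetP => _ /imsetP[c _ ->]; rewrite inE; apply/agreeP => i.
  by rewrite inE ffunE => /negPf->.
have E : splice S' z @: C = [set y | agree (~: S') z y].
  by apply/eqP; rewrite eqEcard sub card_agree setCK card_in_imset // cardC S'd /=.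
have : z \in splice S' z @: C by rewrite E inE; apply/agreeP.
case/imsetP => c0 c0C zE.
have c0z : agree S' z c0.
  by apply/agreeP => i iS'; move/ffunP/(_ i): zE; rewrite ffunE iS' => ->.
rewrite (bigD1 c0) //= c0C big1 ?addr0 // => c /andP[/agreeP cz cc0].
case: (boolP (c \in C)) => // cC; case/eqP: cc0; apply: inj => //.
apply/ffunP => i; rewrite !ffunE; case: ifP => // iS'.
by rewrite cz // (agreeP _ _ _ c0z).
Qed.

(** The random word read by one constraint: the entries in [F] are those of [z],
    and the entry [a] outside [F] is a permuted copy of the symbol [g a] of a
    random codeword.  By the strength of [C] this word is uniform among the
    words that agree with [z] on [F]; hence the hypothesis on [P] is exactly
    what makes its expected payoff equal to the mean. *)
Lemma mds_sum_word (R : realType) q N h d (C : {set word q N})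
    (P : word q h -> R) (g : 'I_h -> option 'I_N)
    (pi : 'I_h -> 'I_N -> {perm 'I_q}) (z : word q h) (c0 : word q N)
    (F := [set a | g a == None]) :
    mds d C -> (d <= N)%N ->
    {in ~: F &, injective g} -> (#|~: F| <= d)%N ->
    \sum_(y | agree F z y) P y = mean P * q%:R ^+ #|~: F| ->
  \sum_(c in C) P [ffun a => if g a is Some i then pi a i (c i) else z a]
    = mean P * q%:R ^+ d.
Proof.
move=> mdsC dN ginj Fd PF.
pose G (c : word q N) : word q h :=
  [ffun a => if g a is Some i then pi a i (c i) else z a].
rewrite (partition_big G (agree F z)) => [|c cC] /=; last first.
  by apply/agreeP => a; rewrite inE ffunE => /eqP->.
rewrite -(subnK Fd) exprD mulrCA -PF mulrC mulr_suml; apply: eq_bigr => y /agreeP yz.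
(* The symbols that a codeword must have at the places read outside [F] for
   the outcome to be [y]; [c0] merely fills the places outside [S]. *)
pose u : word q N := [ffun i =>
  if [pick a | g a == Some i] is Some a then (pi a i)^-1%g (y a) else c0 i].
pose S := [set i | [exists a, g a == Some i]].
have pickg a i : g a = Some i -> [pick b | g b == Some i] = Some a.
  move=> ga; case: pickP => [b /eqP gb|/(_ a)]; last by rewrite ga eqxx.
  by congr Some; apply: ginj; rewrite ?inE ?ga ?gb.
have cardS : #|S| = #|~: F|.
  rewrite -(card_imset _ (@Some_inj _)) -(card_in_imset ginj); apply: eq_card => o.
  apply/imsetP/imsetP => [[i + ->]|[a + ->]]; rewrite inE.
    by case/existsP=> a /eqP ga; exists a; rewrite ?inE ga.
  rewrite inE; case ga: (g a) => [i|//] _; exists i => //.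
  by rewrite inE; apply/existsP; exists a; rewrite ga.
have := @mds_sum_agree R _ N d C S u mdsC dN.
rewrite cardS card_ord => /(_ Fd) <-.
rewrite mulr_sumr [RHS](bigID (mem C)) /= [X in _ + X]big1 ?addr0; last first.
  by move=> c /andP[_ /negPf->]; rewrite mulr0.
apply: congr_big => // c; last by case/andP=> cC /eqP<-; rewrite cC mulr1.
rewrite andbC; case: (boolP (c \in C)) => cC; rewrite ?andbF // !andbT.
apply/eqP/agreeP => [cy i|cu].
  rewrite inE => /existsP[a /eqP ga]; rewrite ffunE (pickg a) //.
  by rewrite -cy ffunE ga permK.
apply/ffunP => a; rewrite ffunE; case ga: (g a) => [i|]; last by rewrite yz // inE ga.
rewrite cu; last by rewrite inE; apply/existsP; exists a; rewrite ga.
by rewrite ffunE (pickg a) // permKV.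
Qed.

(** * Linear MDS codes over a finite field *)

Section Codes.
Variable F : finFieldType.

Definition zeros (X : finType) (f : X -> F) := [set x | f x == 0].

(** By linearity the agreements of two codewords are the zeros of a nonzero
    one.  The weight condition on all of [X] passes to any [N] of its points,
    because zeros can only disappear, and the code remains of dimension [d]
    because [d <= N] keeps the encoder injective. *)
Lemma mds_of_encoder (X : finType) q N d (enc : 'rV[F]_d -> X -> F) :
    #|F| = q -> (d <= N <= #|X|)%N ->
    (forall (w w' : 'rV[F]_d) x, enc (w - w') x = enc w x - enc w' x) ->
    (forall w : 'rV[F]_d, w != 0 -> (#|zeros (enc w)| < d)%N) ->
  exists C : {set word q N}, mds d C.
Proof.
move=> cardF /andP[dN NX] encB wt.
pose f (a : F) : 'I_q := cast_ord cardF (enum_rank a).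
have f_inj : injective f by apply: inj_comp (@cast_ord_inj _ _ _) enum_rank_inj.
pose e (i : 'I_N) : X := enum_val (widen_ord NX i).
have e_inj : injective e.
  by move=> i j /enum_val_inj/(congr1 val) /= ij; apply: val_inj.
pose code w : word q N := [ffun i => f (enc w (e i))].
have dist w w' : w != w' -> (#|[set i | code w i == code w' i]| < d)%N.
  rewrite -subr_eq0 => /wt; apply: leq_ltn_trans.
  rewrite -(card_imset _ e_inj) subset_leq_card //.
  apply/subsetP => _ /imsetP[i + ->].
  by rewrite !inE !ffunE (inj_eq f_inj) encB subr_eq0.
have code_inj : injective code.
  move=> w w' E; apply: contraTeq isT => /dist.
  rewrite E (eq_card (B := predT)) => [|i]; last by rewrite !inE eqxx.
  by rewrite card_ord ltnNge dN.
exists [set code w | w in [set: 'rV[F]_d]]; split.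
  by rewrite card_imset // cardsT card_mx mul1n cardF card_ord.
move=> _ _ /imsetP[w _ ->] /imsetP[w' _ ->] ww'.
by apply: dist; apply: contraNneq ww' => ->.
Qed.

(** A nonzero word of sum zero has at least two nonzero entries. *)
Lemma mds_parity q k : #|F| = q -> exists C : {set word q k.+1}, mds k C.
Proof.
move=> cardF.
pose enc (w : 'rV[F]_k) (x : option 'I_k) :=
  if x is Some j then w 0 j else \sum_j w 0 j.
apply: (mds_of_encoder (enc := enc)) => //.
- by rewrite leqnSn card_option card_ord leqnn.
- by move=> w w' [j|] /=; rewrite ?mxE // -sumrB; apply: eq_bigr => j _; rewrite !mxE.
move=> w w0; have [j wj] : exists j, w 0 j != 0.
  apply/existsP; rewrite -negb_forall; apply: contraNN w0 => /forallP w0.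
  by apply/eqP/rowP => j; rewrite mxE; apply/eqP.
suff [x xj encx] : exists2 x, x != Some j & enc w x != 0.
  have : zeros (enc w) \subset ~: [set Some j; x].
    apply/subsetP => y; rewrite !inE negb_or => y0.
    by apply/andP; split; apply: contraTneq y0 => ->.
  move/subset_leq_card => H; apply: leq_ltn_trans H _.
  rewrite cardsCs setCK cards2 eq_sym xj card_option card_ord.
  by case: k j {enc w w0 wj x xj encx} => [[]|k] // _; rewrite subn2.
case: (altP (\sum_j w 0 j =P 0)) => [s0|]; last by exists None.
suff [i ij wi] : exists2 i, i != j & w 0 i != 0 by exists (Some i).
apply/exists_inP; apply: contraNT wj; rewrite negb_exists_in => /forall_inP w0'.
move/eqP: s0; rewrite (bigD1 j) //= big1 ?addr0 // => i /w0'.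
by rewrite negbK => /eqP.
Qed.

Lemma card_zeros_option (X : finType) (f : option X -> F) :
  #|zeros f| = ((f None == 0)%R + #|zeros (fun x => f (Some x))|)%N.
Proof.
have inj : injective (@Some X) by move=> x y [].
rewrite (cardsD1 None) inE; congr (_ + _)%N.
rewrite -[RHS](card_imset _ inj); apply: eq_card => -[x|].
  by rewrite !inE (mem_imset _ _ inj) inE.
by rewrite !inE /=; apply/esym/imsetP => -[].
Qed.

Lemma card_zeros_horner (p : {poly F}) :
  p != 0 -> (#|zeros (fun a => p.[a])| < size p)%N.
Proof.
move=> p0; rewrite cardE max_poly_roots ?enum_uniq //.
by apply/allP => a; rewrite mem_enum inE.
Qed.

(** Extended Reed-Solomon code.  The value at infinity of a polynomial of degree
    less than [d] is its coefficient of degree [d - 1]. *)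
Definition rs_enc d (w : 'rV[F]_d) (x : option F) : F :=
  if x is Some a then (rVpoly w).[a] else (rVpoly w)`_d.-1.

Lemma rs_encB d (w w' : 'rV[F]_d) x : rs_enc (w - w') x = rs_enc w x - rs_enc w' x.
Proof. by case: x => [a|]; rewrite /= linearB ?hornerE ?coefB. Qed.

Lemma rVpoly_neq0 d (w : 'rV[F]_d) : w != 0 -> rVpoly w != 0.
Proof.
by apply: contraNneq => w0; rewrite -[w]rVpolyK w0 linear0.
Qed.

(** A zero at infinity lowers the degree by one, hence the possible number of
    roots in [F] too. *)
Lemma rs_weight d (w : 'rV[F]_d) : w != 0 -> (#|zeros (rs_enc w)| < d)%N.
Proof.
move=> w0; rewrite card_zeros_option.
have p0 := rVpoly_neq0 w0; have szp : (size (rVpoly w) <= d)%N by apply: size_poly.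
have := card_zeros_horner p0.
case: (altP (rs_enc w None =P 0)) => [/= lc0|_] roots; last exact: leq_trans szp.
rewrite add1n; apply: leq_ltn_trans roots _.
rewrite ltn_neqAle szp andbT; apply: contraNneq p0 => szd.
by rewrite -lead_coef_eq0 /lead_coef szd lc0.
Qed.

Lemma mds_reed_solomon q N d : #|F| = q -> (d <= N <= q + 1)%N ->
  exists C : {set word q N}, mds d C.
Proof.
move=> cardF dNq; apply: (mds_of_encoder (enc := @rs_enc d)) => //.
- by rewrite card_option cardF -addn1.
- exact: rs_encB.
- exact: rs_weight.
Qed.

(** The columns of this code are the points of a hyperoval: the conic
    [(1 : a : a ^ 2)] with its point at infinity [(0 : 0 : 1)], and the nucleus
    [(0 : 1 : 0)] through which, in characteristic 2, all its tangents pass. *)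
Definition hyperoval_enc (w : 'rV[F]_3) (x : option (option F)) : F :=
  if x is Some x' then rs_enc w x' else (rVpoly w)`_1.

(** If the coefficient of ['X] vanishes, what remains is [c0 + c2 * a ^ 2], with
    the zero at infinity counted when [c2 = 0].  It has at most one zero in all,
    because squaring is injective in characteristic 2. *)
Lemma hyperoval_weight (w : 'rV[F]_3) : 2%N \in [pchar F] -> w != 0 ->
  (#|zeros (hyperoval_enc w)| < 3)%N.
Proof.
move=> char2 w0; rewrite card_zeros_option.
case: (altP (hyperoval_enc w None =P 0)) => [/= p1|_]; last exact: rs_weight.
rewrite add1n ltnS ltnNge; apply: contra w0 => /card_gt1P[x [y []]].
have pE a : (rVpoly w).[a] = (rVpoly w)`_0 + (rVpoly w)`_2 * a ^+ 2.
  rewrite (@horner_coef_wide _ 3) ?size_poly // !big_ord_recl big_ord0 /=.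
  by rewrite p1 mul0r add0r addr0 expr0 mulr1.
rewrite !inE => x0 y0 xy.
suff [p0 p2] : (rVpoly w)`_0 = 0 /\ (rVpoly w)`_2 = 0.
  apply/eqP/rowP => i; rewrite mxE -coef_rVpoly_ord.
  by case: i => [[|[|[]]]] //= _.
(* Of two distinct zeros of the extended Reed-Solomon word, one is finite. *)
wlog [a xE] : x y xy x0 y0 / exists a, x = Some a.
  move=> H; case: x y x0 y0 xy => [a|] [b|] // x0 y0 xy.
  - by apply: (H (Some a) (Some b)) => //; exists a.
  - by apply: (H (Some a) None) => //; exists a.
  - by apply: (H (Some b) None) => //; exists b.
subst x; move: x0 y0; rewrite /= pE; case: y xy => [b|] ab /=; last first.
  by move=> + /eqP p2; rewrite p2 mul0r addr0 => /eqP.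
rewrite pE => /eqP a0 /eqP b0.
have : (rVpoly w)`_2 * (a - b) ^+ 2 = 0.
  rewrite -(pFrobenius_autE char2) rmorphB /= !pFrobenius_autE mulrBr.
  by apply: (addrI ((rVpoly w)`_0)); rewrite addrA a0 sub0r addr0 -(addr0_eq b0) opprK.
move/eqP; rewrite mulf_eq0 expf_eq0 /= subr_eq0 => /orP[/eqP p2|/eqP E].
  by move: a0; rewrite p2 mul0r addr0.
by rewrite E eqxx in ab.
Qed.

Lemma mds_hyperoval q N : 2%N \in [pchar F] -> #|F| = q -> (3 <= N <= q + 2)%N ->
  exists C : {set word q N}, mds 3 C.
Proof.
move=> char2 cardF Nq; apply: (mds_of_encoder (enc := hyperoval_enc)) => //.
- by rewrite !card_option cardF -[q.+2]addn2.
- by move=> w w' [x|]; [exact: rs_encB | rewrite /= linearB coefB].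
- by move=> w; apply: hyperoval_weight.
Qed.

End Codes.

(** * Averaging over the solutions given by a code *)

Section Reduction.
Variable R : realType.

Lemma increasing_inj h n (J : 'I_h -> 'I_n) : increasing J -> injective J.
Proof.
move=> Jinc a b E; apply: val_inj; apply/eqP; apply: contraT.
by rewrite neq_ltn => /orP[] /Jinc; rewrite E ltnn.
Qed.

Lemma enum_val_increasing h (S : {set 'I_h}) (i j : 'I_#|S|) :
  (i < j)%N -> (enum_val i < enum_val j)%N.
Proof.
move=> ij; have x0 : 'I_h := enum_val i.
have srt : sorted ltn [seq val x | x <- enum S].
  apply: subseq_sorted (iota_ltn_sorted 0 h); first exact: ltn_trans.
  by rewrite -val_enum_ord map_subseq // enumT; apply: filter_subseq.
have szi := ltn_ord i; have szj := ltn_ord j.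
rewrite !(enum_val_nth x0) -!(nth_map x0 0%N val) -?cardE //.
by rewrite (sorted_ltn_nth ltn_trans) // inE size_map -cardE.
Qed.

(** The definition of balance speaks of [t] entries listed in increasing order;
    this is its form for arbitrary sets of at most [t] entries. *)
Lemma balanced_sum_agree q t h (P : word q h -> R) (S : {set 'I_h}) (z : word q h) :
    (0 < q)%N -> balanced_indep t P -> (#|S| <= t)%N ->
  \sum_(y | agree S z y) P y = mean P * q%:R ^+ #|~: S|.
Proof.
move=> q0 [th bal] St.
have qn0 n : q%:R ^+ n != 0 :> R by rewrite expf_neq0 // pnatr_eq0 -lt0n.
have [|S' SS' S't] := @extend_set _ S t; first by rewrite St card_ord.
rewrite (sum_agree_sub (r := mean P * q%:R ^+ (h - t)) z SS') => [|z'].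
  rewrite S't card_ord -[LHS]mulr_natr natrX -mulrA -exprD; congr (_ * _ ^+ _).
  by rewrite addnBA // subnK // -[X in (X - _)%N](card_ord h) -(cardsC S) addKn.
pose J (a : 'I_t) : 'I_h := enum_val (cast_ord (esym S't) a).
have Jinc : increasing J by move=> a b ab; apply: enum_val_increasing.
rewrite -(bal J Jinc (subword J z')) mulfVK //; apply: eq_bigl => y.
apply/agreeP/eqP => [yz|E i iS'].
  by apply/ffunP => a; rewrite !ffunE yz // enum_valP.
have /ffunP/(_ (cast_ord S't (enum_rank_in iS' i))) := E.
by rewrite !ffunE /J cast_ordK enum_rankK_in.
Qed.

(** Under the uniform distribution distinct variables are independent: this is
    [mds_sum_word] for the code of all words, with nothing kept fixed. *)
Lemma sum_subword q n h (P : word q h -> R) (J : 'I_h -> 'I_n) :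
    (0 < q)%N -> injective J ->
  \sum_(x : word q n) P (subword J x) = mean P * q%:R ^+ n.
Proof.
move=> q0 Jinj; pose z h' : word q h' := [ffun=> Ordinal q0].
have F0 : [set a | Some (J a) == None] = set0 by apply/setP => a; rewrite !inE.
rewrite -(@mds_sum_word R q n h n setT P (fun a => Some (J a)) (fun _ _ => 1%g)
  (z h) (z n) (mds_setT _ n) (leqnn n)) ?F0.
- apply: eq_big => [x|x _]; first by rewrite inE.
  by congr P; apply/ffunP => a; rewrite !ffunE perm1.
- by move=> a b _ _ [/Jinj].
- by have := leq_card J Jinj; rewrite setC0 cardsT !card_ord.
rewrite setC0 cardsT card_ord mulfVK ?expf_neq0 ?pnatr_eq0 -?lt0n //.
by apply: eq_bigl => y; apply/agreeP => a; rewrite inE.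
Qed.

Lemma mean_value k q (I : csp R k q) : (0 < q)%N ->
  mean (@value R k q I) = \sum_i weight i * mean (@payoff R k q I i).
Proof.
move=> q0; rewrite /mean /value exchange_big mulr_suml; apply: eq_bigr => i _ /=.
rewrite -mulr_sumr sum_subword ?mulrA ?mulfK ?expf_neq0 ?pnatr_eq0 -?lt0n //.
exact/increasing_inj/scope_increasing.
Qed.

(** The transposition of [c0 l] and [x0 j] serves to send [c0] to [x0] while
    preserving uniformity, with no group structure on the alphabet. *)
Definition perturb q t N n (col : 'I_n -> 'I_t + 'I_N) (c0 : word q N) (x0 : word q n)
    (c : word q N) : word q n :=
  [ffun j => if col j is inr l then tperm (c0 l) (x0 j) (c l) else x0 j].

Lemma perturb_base q t N n (col : 'I_n -> 'I_t + 'I_N) c0 (x0 : word q n) :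
  perturb col c0 x0 c0 = x0.
Proof. by apply/ffunP => j; rewrite ffunE; case: (col j) => // l; rewrite tpermL. Qed.

(** At most [t] entries of a scope lie in the [t] fixed classes, so that balance
    applies to them; the others are at most [k] by arity and at most [N] by
    the colouring, hence within the strength [d] of the code. *)
Lemma value_sum_mds k q t N d (I : csp R k q) (C : {set word q N}) (c0 : word q N)
    (x0 : word q (nvar I)) (col : 'I_(nvar I) -> 'I_t + 'I_N) :
    (0 < q)%N -> csp_indep t I -> mds d C -> (minn k N <= d <= N)%N ->
    (forall i, injective (fun a => col (@con_scope R k q I i a))) ->
  \sum_(c in C) value (perturb col c0 x0 c)
    = mean (@value R k q I) * q%:R ^+ d.
Proof.
move=> q0 ind mdsC /andP[kd dN] colJ.
rewrite mean_value // mulr_suml exchange_big; apply: eq_bigr => i _ /=.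
rewrite -mulr_sumr -mulrA; congr (_ * _).
set J := @con_scope R k q I i in colJ *.
pose g a := if col (J a) is inr l then Some l else None.
pose F := [set a | g a == None].
have ginj : {in ~: F &, injective g}.
  move=> a b; rewrite !inE /g => Fa Fb E; apply: (colJ i) => /=; rewrite -/J.
  by case: (col (J a)) (col (J b)) Fa Fb E => l [] l' //= _ _ [->].
have card_le (A : {set 'I_(arity i)}) m (f : 'I_m -> 'I_t + 'I_N) :
    (forall a, a \in A -> exists s, col (J a) = f s) -> (#|A| <= m)%N.
  move=> Af; rewrite -(card_imset _ (colJ i)) -[m]card_ord -cardsT.
  apply: leq_trans (leq_imset_card f _); apply: subset_leq_card.
  apply/subsetP => _ /imsetP[a /Af[s E] ->]; apply/imsetP; exists s => //.
have Ft : (#|F| <= t)%N.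
  apply: (card_le _ _ inl) => a; rewrite inE /g.
  by case: (col (J a)) => // s _; exists s.
have Fd : (#|~: F| <= d)%N.
  apply: leq_trans kd; rewrite leq_min; apply/andP; split.
    have /andP[_] := arity_bounds i; rewrite leq_min => /andP[+ _].
    by apply: leq_trans; rewrite -[X in (_ <= X)%N]card_ord max_card.
  apply: (card_le _ _ inr) => a; rewrite !inE /g.
  by case: (col (J a)) => // s _; exists s.
rewrite -(mds_sum_word (fun a l => tperm (c0 l) (x0 (J a))) c0 mdsC dN ginj Fd
  (balanced_sum_agree (subword J x0) q0 (ind i) Ft)).
apply: eq_bigr => c _; congr payoff; apply/ffunP => a.
by rewrite !ffunE /g; case: (col (J a)).
Qed.

(** If a family of solutions has the mean value as its average and contains an
    optimal one, all the others being at worst [wor I], then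
    [mean - wor I >= (opt I - wor I) / #|C|], with both signs reversed when
    minimizing. *)
Lemma ratio_ge_of_average k q (I : csp R k q) (T : finType) (X : T -> word q (nvar I))
    (C : {set T}) (c0 : T) :
    opt I <> wor I -> c0 \in C -> value (X c0) = opt I ->
    \sum_(c in C) value (X c) = mean (@value R k q I) * #|C|%:R ->
  1 / #|C|%:R <= avg_diff_ratio I.
Proof.
move=> /eqP neq c0C Xopt avg.
have C0 : 0 < #|C|%:R :> R by rewrite ltr0n (cardD1 c0) c0C.
(* The contributions of the solutions other than [X c0] all have the sign of
   [opt I - wor I]. *)
have excess : opt I - wor I + \sum_(c in C | c != c0) (value (X c) - wor I)
    = (mean (@value R k q I) - wor I) * #|C|%:R.
  rewrite mulrBl -avg mulr_natr -sumr_const -sumrB [RHS](bigD1 c0) //=.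
  by rewrite Xopt.
rewrite /avg_diff_ratio.
have [[_ vmax] [_ vmin]] := (max_valP (@value R k q I) (X c0), min_valP (@value R k q I) (X c0)).
move: neq Xopt excess; rewrite /opt /wor; case: (goal I) => neq Xopt excess.
  have gt0 : 0 < max_val (@value R k q I) - min_val (@value R k q I).
    by rewrite subr_gt0 lt_neqAle eq_sym neq -Xopt vmin.
  rewrite ler_pdivlMr // mulrAC mul1r ler_pdivrMr // -excess lerDl.
  by apply: sumr_ge0 => c _; rewrite subr_ge0 vmin.
have lt0 : min_val (@value R k q I) - max_val (@value R k q I) < 0.
  by rewrite subr_lt0 lt_neqAle neq -Xopt vmax.
rewrite ler_ndivlMr // mulrAC mul1r ler_pdivlMr // -excess gerDl.
by apply: sumr_le0 => c _; rewrite subr_le0 vmax.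
Qed.

Lemma strong_coloring_fun k q (I : csp R k q) :
  exists col : 'I_(nvar I) -> 'I_(strong_chromatic I),
    forall i, injective (fun a => col (@con_scope R k q I i a)).
Proof.
rewrite /strong_chromatic; case: ex_minnP => nu /existsP[D /andP[/andP[partD]]].
move=> /forallP Dcol /eqP<- _; have [covD trivD _] := and3P partD.
have inD j : pblock D j \in D by rewrite pblock_mem // (eqP covD) inE.
exists (fun j => enum_rank_in (inD j) (pblock D j)) => i a b E.
have {}E : pblock D (@con_scope R k q I i a) = pblock D (@con_scope R k q I i b).
  by move/(congr1 enum_val): E; rewrite !enum_rankK_in.
have /forall_inP/(_ _ (inD (@con_scope R k q I i a))) := Dcol i.
apply: contraTeq => ab; rewrite -ltnNge; apply/card_gt1P.
exists (@con_scope R k q I i a), (@con_scope R k q I i b).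
rewrite !inE !imset_f //= {2}E !mem_pblock (eqP covD) !inE; split=> //.
by apply: contraNneq ab => /(increasing_inj (@scope_increasing _ _ _ I i)) ->.
Qed.

Lemma ratio_ge_of_mds k q t N d (I : csp R k q) (C : {set word q N}) :
    (0 < q)%N -> csp_indep t I -> opt I <> wor I ->
    strong_chromatic I = (t + N)%N -> mds d C -> (minn k N <= d <= N)%N ->
  1 / q%:R ^+ d <= avg_diff_ratio I.
Proof.
move=> q0 ind neq nuE mdsC kdN.
have cardC : #|C| = (q ^ d)%N by case: (mdsC) => ->; rewrite card_ord.
have /card_gt0P[c0 c0C] : (0 < #|C|)%N by rewrite cardC expn_gt0 q0.
have [x0 x0opt] : exists x, opt I = @value R k q I x.
  pose z : word q (nvar I) := [ffun=> Ordinal q0].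
  have [[xM EM] _] := max_valP (@value R k q I) z.
  have [[xm Em] _] := min_valP (@value R k q I) z.
  by rewrite /opt; case: (goal I); [exists xM | exists xm].
have [col colJ] := strong_coloring_fun I.
pose col' j := split (cast_ord nuE (col j)).
rewrite -natrX -cardC.
apply: (@ratio_ge_of_average k q I _ (perturb col' c0 x0) C c0) => //.
  by rewrite perturb_base.
rewrite (value_sum_mds c0 x0 q0 ind mdsC kdN) ?cardC ?natrX // => i a b.
by move=> E; apply: colJ; apply: (@cast_ord_inj _ _ nuE); exact: (can_inj (@splitK t N)) E.
Qed.

End Reduction.

(** * The bounds *)

Lemma prime_power_field q : prime_power q ->
  exists2 F : finFieldType, #|F| = q & forall e, q = (2 ^ e)%N -> 2%N \in [pchar F].
Proof.
move=> [p [e [p_pr e0 ->]]]; have [F charF cardF] := pPrimePowerField p_pr e0.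
exists F => // e' E; suff E2 : 2%N = p by rewrite E2.
have : (p %| 2 ^ e')%N by rewrite -E; apply: dvdn_exp.
by rewrite Euclid_dvdX // dvdn_prime2 // => /andP[/eqP].
Qed.

Unset Implicit Arguments.
Set Strict Implicit.

Theorem corollary2p7 (R : realType) (q k t : nat)
    (q_ge2 : (2 <= q)%N) (k_ge2 : (2 <= k)%N) (t_bounds : (1 <= t <= k - 1)%N)
    (q_pp : prime_power q)
    (I : csp R k q) (I_indep : csp_indep t I)
    (nu : nat) (nuE : nu = strong_chromatic I)
    (nu_bounds : (k <= nu <= maxn (k + t + 1) (q + t + 2))%N)
    (opt_neq_wor : opt I <> wor I) :
  ((nu - t <= k)%N -> 1 / q%:R ^+ (nu - t) <= avg_diff_ratio I) /\
  ((nu - t <= k + 1)%N \/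
   ((k < q)%N /\ (nu - t <= q + 1)%N) \/
   [/\ k = 3%N, (3 < q)%N, (exists e : nat, q = (2 ^ e)%N) & (nu - t <= q + 2)%N] ->
   1 / q%:R ^+ k <= avg_diff_ratio I).
Proof.
have q0 : (0 < q)%N by apply: ltnW.
have tnu : (t <= nu)%N by lia.
have nuN : strong_chromatic I = (t + (nu - t))%N by rewrite subnKC // nuE.
move: (nu - t)%N nuN => N {nu nuE nu_bounds tnu} nuN.
have ratioC d := @ratio_ge_of_mds R k q t N d I _ q0 I_indep opt_neq_wor nuN.
have part1 : 1 / q%:R ^+ N <= avg_diff_ratio I.
  by apply: ratioC (mds_setT _ N) _; rewrite geq_minr leqnn.
split=> // H; have [Nk|kN] := leqP N k.
  apply: le_trans part1; rewrite !div1r lef_pV2 ?posrE ?exprn_gt0 ?ltr0n //.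
  by rewrite ler_eXn2l ?ltr1n.
have [F cardF charF] := prime_power_field q_pp.
suff [C mdsC] : exists C : {set word q N}, mds k C.
  by apply: ratioC mdsC _; rewrite geq_minl ltnW.
case: H => [Nk1|[[_ Nq]|[k3 _ [e qe] Nq]]].
- have -> : N = k.+1 by lia.
  exact: mds_parity cardF.
- by apply: (mds_reed_solomon (F := F)) => //; rewrite ltnW.
- subst k; apply: (mds_hyperoval (F := F)) => //; last by rewrite ltnW.
  exact: charF qe.
Qed.
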